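(* Let $n\ge 2$, let $p(z)=z^n+a_{n-1}z^{n-1}+\cdots+a_1z+a_0$ be a monic polynomial with complex coefficients $a_0,a_1,\ldots,a_{n-1}$, and let $\lambda\in\mathbb{C}$ be any zero of $p(z)$. Then \[ |\lambda|\leq \left|\frac{a_{n-1}}{n}\right|+\cos\frac{\pi}{n}+\frac{1}{2}\left[(1+\alpha)^2+4\alpha+4\sqrt{\alpha}(1+\alpha)\right]^{\frac{1}{4}}, \] where, with $a_n=1$, \[ \alpha_{r}=\sum_{k=r}^{n} \binom{k}{r}\left(-\frac{a_{n-1}}{n}\right)^{k-r} a_{k}\quad (r=0,1,\ldots,n-2),\qquad \alpha=\sum_{i=0}^{n-2}|\alpha_i|^2. \]
   Context: Here $\binom{k}{r}$ is the binomial coefficient (with $\binom{0}{0}=1$), and a zeroth power equals $1$ (including $0^0=1$). *)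

(* Defs.v *)
From mathcomp Require Import all_boot all_order all_algebra.
From mathcomp Require Import complex.
From mathcomp Require Import reals trigo exp.

Set Implicit Arguments.
Unset Strict Implicit.
Unset Printing Implicit Defensive.

Import Order.TTheory GRing.Theory Num.Theory.
Export ComplexField.Normc.

Local Open Scope ring_scope.

(* Coefficients a_k are p`_k.  The modulus is normc : R[i] -> R rather than the
   generic norm `|_|, which on R[i] takes its values in R[i]. *)

Definition alpha_coef (R : realType) (n : nat) (p : {poly R[i]}) (r : nat)
    : R[i] :=
  \sum_(r <= k < n.+1) 'C(k, r)%:R * (- (p`_n.-1 / n%:R)) ^+ (k - r) * p`_k.

Definition alpha (R : realType) (n : nat) (p : {poly R[i]}) : R :=
  \sum_(0 <= i < n.-1) normc (alpha_coef n p i) ^+ 2.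

(* Main.v *)
Require Import Defs.
From mathcomp Require Import all_boot all_order all_algebra.
From mathcomp Require Import complex.
From mathcomp Require Import reals trigo exp.
From mathcomp Require Import ring lra.

(** With [s = sqrt alpha] the bracket in the bound is a perfect fourth power,
    [(1 + s ^+ 2) ^+ 2 + 4 * s ^+ 2 + 4 * s * (1 + s ^+ 2) = (1 + s) ^+ 4], so
    the claim is [|lambda| <= |c| + cos (pi / n) + (1 + s) / 2], where
    [c = a_(n-1) / n].

    Translating the variable by [c] removes the term of degree [n - 1]: the
    [alpha_r] are the Taylor coefficients of [p] at [- c], and [mu = lambda + c]
    satisfies [mu ^+ n + \sum_(i < n - 1) alpha_i * mu ^+ i = 0]
    ([depressed_root]).  As [|lambda| <= |c| + |mu|], it remains to bound
    [t = |mu|], knowing that [t ^+ n <= \sum_(i < n - 1) |alpha_i| * t ^+ i].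

    For [n = 2] this reads [t ^+ 2 <= s], and [t <= (1 + s) / 2] is the
    arithmetic-geometric mean inequality, [cos (pi / 2)] being [0].

    For [n >= 3] the cosine is at least [cos (pi / 3) = 1 / 2], and it suffices
    that [t <= 1 + s / 2] ([gap_bound]).  If [t > 1], the Cauchy-Schwarz
    inequality and the geometric sum of the [t ^+ (2 * i)] give
    [t ^+ 2 * (t ^+ 2 - 1) <= s ^+ 2], whereas [t > 1 + s / 2] would give
    [s ^+ 2 < 4 * (t - 1) ^+ 2 <= t ^+ 2 * (t ^+ 2 - 1)].  The gap in degree
    [n - 1] is what produces the factor [t ^+ 2] here. *)

Import Order.TTheory GRing.Theory Num.Theory.

Local Open Scope ring_scope.

(** * The modulus *)

Lemma normc_ge0 (R : rcfType) (x : R[i]) : 0 <= normc x.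
Proof. by case: x => a b; apply: sqrtr_ge0. Qed.

Lemma normcX (R : rcfType) (x : R[i]) (k : nat) : normc (x ^+ k) = normc x ^+ k.
Proof.
elim: k => [|k IHk]; first by rewrite !expr0 normc1.
by rewrite !exprS normcM IHk.
Qed.

Lemma ler_normc_sum (R : rcfType) (m : nat) (F : 'I_m -> R[i]) :
  normc (\sum_(i < m) F i) <= \sum_(i < m) normc (F i).
Proof.
apply: (big_ind2 (fun u a => normc u <= a)) => [|u a v b ua vb|//].
  by rewrite normc0.
by apply: le_trans (lerD ua vb); apply: le_normcD.
Qed.

(** * Removing the term of degree n - 1 *)

Section Depressed.

Variables (R : realType) (n : nat) (p : {poly R[i]}).
Hypothesis size_p : size p = n.+1.

Let c : R[i] := p`_n.-1 / n%:R.

(** Both sides are the coefficient of [X ^+ r] in [p (X - c)]; this is what lets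
    Taylor's formula apply to the sums [alpha_coef]. *)
Lemma alpha_coef_taylor (r : nat) : (r <= n)%N ->
  alpha_coef n p r = (p^`N(r)).[- c].
Proof.
move=> le_rn.
rewrite (@horner_coef_wide _ (n.+1 - r)); last first.
  by rewrite /nderivn size_p; apply: size_poly.
rewrite /alpha_coef -/c -{1}[r]add0n big_addn big_mkord.
apply: eq_bigr => i _.
rewrite coef_nderivn addnK [(r + i)%N]addnC.
by rewrite -[in RHS]mulr_natl mulrAC.
Qed.

Lemma alpha_coef_lead : alpha_coef n p n = p`_n.
Proof. by rewrite /alpha_coef big_nat1 binn subnn expr0 !mul1r. Qed.

(** The shift [c] is chosen for this: the two surviving terms are [a_(n-1)] and
    [- n * c]. *)
Lemma alpha_coef_sublead : p \is monic -> (0 < n)%N ->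
  alpha_coef n p n.-1 = 0.
Proof.
move=> /monicP; rewrite lead_coefE size_p /= => pn1.
move: @c pn1; rewrite /alpha_coef; case: (n) => [//|m] /= pm1 _.
rewrite big_nat_recl // big_nat1 binn subnn expr0 !mul1r.
rewrite subSnn expr1 binSn pm1 mulr1 mulrN mulrC divfK ?subrr //.
by rewrite pnatr_eq0.
Qed.

Lemma depressed_root (x : R[i]) : p \is monic -> (0 < n)%N -> root p x ->
  (x + c) ^+ n = - \sum_(i < n.-1) alpha_coef n p i * (x + c) ^+ i.
Proof.
move=> p_monic n_gt0 /rootP px0.
have : p.[- c + (x + c)] = 0 by rewrite addrC addrK.
rewrite (@nderiv_taylor_wide _ n.+1) ?size_p //; last exact: mulrC.
rewrite (eq_bigr (fun i : 'I_n.+1 => alpha_coef n p i * (x + c) ^+ i));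
  last by move=> i _; rewrite alpha_coef_taylor // -ltnS.
rewrite big_ord_recr /= alpha_coef_lead.
move/monicP: (p_monic); rewrite lead_coefE size_p /= => ->; rewrite mul1r.
have := alpha_coef_sublead p_monic n_gt0.
rewrite -(prednK n_gt0) big_ord_recr /= => ->.
by rewrite mul0r addr0 => /eqP; rewrite addrC addr_eq0 => /eqP.
Qed.

End Depressed.

(** * Real inequalities *)

(** The inequality comes from the nonnegative sum of the squares
    [(B * x i - S * y i) ^+ 2], where [S], [A] and [B] are the sums of the
    [x i * y i], the [x i ^+ 2] and the [y i ^+ 2]: it equals [B * (A * B - S ^+ 2)]. *)
Lemma cauchy_schwarz_sum (R : realFieldType) (m : nat) (x y : 'I_m -> R) :
  (\sum_(i < m) x i * y i) ^+ 2 <=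
    (\sum_(i < m) x i ^+ 2) * (\sum_(i < m) y i ^+ 2).
Proof.
set S := \sum_(i < m) _; set A := \sum_(i < m) x i ^+ 2.
set B := \sum_(i < m) y i ^+ 2.
have sq0 (a b : R) : 0 <= a ^+ 2 * A - 2 * a * b * S + b ^+ 2 * B.
  rewrite [leRHS](_ : _ = \sum_(i < m) (a * x i - b * y i) ^+ 2).
    by apply: sumr_ge0 => i _; apply: sqr_ge0.
  rewrite !mulr_sumr -sumrN -!big_split /=; apply: eq_bigr => i _; ring.
have B0 : 0 <= B by apply: sumr_ge0 => i _; apply: sqr_ge0.
have [B_gt0|] := ltP 0 B; last first.
  move=> B_le0; have {B_le0}B0' : B = 0 by apply/le_anti/andP.
  rewrite B0' mulr0.
  have y0 i : y i = 0.
    apply/eqP; rewrite -sqrf_eq0; apply/eqP; apply: psumr_eq0P B0' i _ => // i _.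
    exact: sqr_ge0.
  by rewrite /S big1 ?expr0n // => i _; rewrite y0 mulr0.
have := sq0 B S; rewrite (_ : _ + _ = B * (A * B - S ^+ 2)); last by ring.
by rewrite pmulr_rge0 // subr_ge0.
Qed.

(** With [s] the square root, Cauchy-Schwarz bounds [t ^+ (2 * m + 2)] by
    [s ^+ 2] times the geometric sum [G] of ratio [t ^+ 2], and
    [(t ^+ 2 - 1) * G] is less than [t ^+ (2 * m)]; cancelling this power leaves
    [t ^+ 2 * (t ^+ 2 - 1) <= s ^+ 2], which excludes [2 * (t - 1) > s]. *)
Lemma gap_bound (R : rcfType) (m : nat) (x : 'I_m -> R) (t : R) :
  t ^+ m.+1 <= \sum_(i < m) x i * t ^+ i ->
  t <= 1 + Num.sqrt (\sum_(i < m) x i ^+ 2) / 2.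
Proof.
move=> le_t; rewrite leNgt; apply/negP.
set A := \sum_(i < m) x i ^+ 2 => lt_t.
have s_ge0 := sqrtr_ge0 A.
have A0 : 0 <= A by apply: sumr_ge0 => i _; apply: sqr_ge0.
have := sqr_sqrtr A0; move: s_ge0 lt_t; set s := Num.sqrt A.
move=> s_ge0 lt_t sqA.
have t_gt1 : 1 < t by lra.
have t_gt0 : 0 < t by lra.
pose G := \sum_(i < m) (t ^+ i) ^+ 2; pose T := (t ^+ 2) ^+ m.
have geom : T - 1 = (t ^+ 2 - 1) * G.
  by rewrite /T subrX1; congr (_ * _); apply: eq_bigr => i _; rewrite exprAC.
have T_gt0 : 0 < T by rewrite !exprn_gt0.
have sq_le : T * t ^+ 2 <= A * G.
  rewrite (_ : T * _ = (t ^+ m.+1) ^+ 2); last first.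
    by rewrite /T -exprSr -!exprM mulnC.
  apply: le_trans (cauchy_schwarz_sum _ _ _ _).
  have tm_ge0 : 0 <= t ^+ m.+1 by rewrite exprn_ge0 // ltW.
  by rewrite ler_sqr ?nnegrE // (le_trans tm_ge0 le_t).
have t2_gt1 : 0 < t ^+ 2 - 1 by nra.
have key : t ^+ 2 * (t ^+ 2 - 1) <= s ^+ 2.
  rewrite -(ler_pM2l T_gt0) sqA mulrA.
  apply: le_trans (_ : A * G * (t ^+ 2 - 1) <= _); first by rewrite ler_pM2r.
  by rewrite -mulrA [G * _]mulrC -geom mulrC ler_wpM2r // lerBlDr lerDl.
have s_small : s ^+ 2 < 4 * (t - 1) ^+ 2 by nra.
have : 4 * (t - 1) ^+ 2 <= t ^+ 2 * (t ^+ 2 - 1).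
  rewrite -subr_ge0.
  rewrite (_ : _ - _ = (t - 1) * (2 + (t - 1) + 4 * (t - 1) ^+ 2
                                  + (t - 1) ^+ 3)); last by ring.
  have : 0 <= t - 1 by lra.
  move: (t - 1) => w w_ge0.
  by rewrite mulr_ge0 // !addr_ge0 ?mulr_ge0 ?exprn_ge0 ?ler0n.
lra.
Qed.

Lemma cos_pi_div3 (R : realType) : cos (pi / 3) = 2^-1 :> R.
Proof.
have pi_gt0 := pi_gt0 R.
have c_gt0 : 0 < cos (pi / 3 : R) by apply: cos_gt0_pihalf; lra.
(* As [2 * (pi / 3) = pi - pi / 3], the cosine [c] satisfies
   [2 * c ^+ 2 - 1 = - c]. *)
have : cos (pi / 3 + pi / 3 : R) = - cos (pi / 3).
  by rewrite (_ : _ + _ = - (pi / 3) + pi) ?cosDpi ?cosN //; lra.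
have := cos2Dsin2 (pi / 3 : R); rewrite cosD.
set u := cos _ in c_gt0 *; set v := sin _ => uv e.
have : (2 * u - 1) * (u + 1) = 0 by nra.
by move/eqP; rewrite mulf_eq0 => /orP[] /eqP ?; lra.
Qed.

Lemma cos_pi_div_ge_half (R : realType) (n : nat) : (2 < n)%N ->
  2^-1 <= cos (pi / n%:R) :> R.
Proof.
move=> n_gt2; have pi_gt0 := pi_gt0 R; rewrite -cos_pi_div3.
have n3 : 3 <= n%:R :> R by rewrite ler_nat.
have le3 : pi / n%:R <= pi / 3 :> R.
  by rewrite ler_pM2l // lef_pV2 ?posrE //; lra.
have ge0 : 0 <= pi / n%:R :> R by rewrite divr_ge0 //; lra.
by rewrite leNgt ltr_cos -?leNgt // in_itv /=; lra.
Qed.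

Lemma bracket_fourth_root (R : realType) (a : R) : 0 <= a ->
  ((1 + a) ^+ 2 + 4 * a + 4 * Num.sqrt a * (1 + a)) `^ (4^-1) =
    1 + Num.sqrt a.
Proof.
move=> a_ge0; have := sqrtr_ge0 a; have := sqr_sqrtr a_ge0.
move: (Num.sqrt a) => s <- s_ge0.
rewrite [X in X `^ _](_ : _ = (1 + s) ^+ 4); last by ring.
have s1_ge0 : 0 <= 1 + s by lra.
by rewrite -powR_mulrn // -powRrM divff ?pnatr_eq0 // powRr1.
Qed.

Theorem theorem3p1 (R : realType) (n : nat) (p : {poly R[i]}) (lambda : R[i])
    (hn : (2 <= n)%N) (p_monic : p \is monic) (p_size : size p = n.+1)
    (p_root : root p lambda) :
  normc lambda <=
    normc (p`_n.-1 / n%:R) + cos (pi / n%:R)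
    + 2^-1 * ((1 + alpha n p) ^+ 2 + 4 * alpha n p
              + 4 * Num.sqrt (alpha n p) * (1 + alpha n p)) `^ (4^-1).
Proof.
have n_gt0 : (0 < n)%N by apply: ltnW.
pose c := p`_n.-1 / n%:R; pose t := normc (lambda + c).
have alphaE : alpha n p = \sum_(i < n.-1) normc (alpha_coef n p i) ^+ 2.
  by rewrite /alpha big_mkord.
rewrite bracket_fourth_root; last first.
  by rewrite alphaE; apply: sumr_ge0 => i _; apply: sqr_ge0.
have t_ge0 : 0 <= t := normc_ge0 _ _.
have le_t : t ^+ n.-1.+1 <= \sum_(i < n.-1) normc (alpha_coef n p i) * t ^+ i.
  rewrite prednK // /t -normcX depressed_root // normcN.
  apply: le_trans (ler_normc_sum _ _ _) _.
  by apply: ler_sum => i _; rewrite normcM normcX.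
have tri : normc lambda <= normc c + t.
  rewrite -[lambda](addrK c) addrC -[normc c]normcN.
  exact: le_normcD.
suff : t <= cos (pi / n%:R) + 2^-1 * (1 + Num.sqrt (alpha n p)).
  by move: tri; rewrite /c; lra.
rewrite alphaE; have [n_gt2|n_le2] := ltnP 2 n.
  by have := gap_bound _ _ _ _ le_t; have := cos_pi_div_ge_half R n n_gt2; lra.
have n2 : n = 2%N by apply/anti_leq/andP.
move: le_t; rewrite n2 /= !big_ord1 expr0 mulr1 cos_pihalf sqrtr_sqr.
rewrite ger0_norm ?normc_ge0 // => le_t.
have := sqr_ge0 (t - 1); nra.
Qed.
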